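(* Every polynomial identity of degree $\le 4$ satisfied by the bilinear operation $[x,y]=\alpha(x\wedge y)$ on the $\mathfrak{sl}(2,\mathbb{C})$-module $V(6)$ is a consequence of the defining identities for Malcev algebras, namely $$[a,b]+[b,a]\equiv 0,$$ $$[[[a,c],b],d]+[[[d,a],c],b]+[[[c,b],d],a]+[[[b,d],a],c]-[[a,b],[c,d]]\equiv 0.$$
   Context: $V(6)$ is the 7-dimensional irreducible $\mathfrak{sl}(2,\mathbb{C})$-module with basis $v_6,v_4,v_2,v_0,v_{-2},v_{-4},v_{-6}$ of $H$-eigenvectors, where $H\cdot v_{6-2i}=(6-2i)v_{6-2i}$, $E\cdot v_{6-2i}=(7-i)v_{6-2(i-1)}$, $F\cdot v_{6-2i}=(i+1)v_{6-2(i+1)}$ (with $v_8=v_{-8}=0$). The map $\alpha\colon\Lambda^2V(6)\to V(6)$ is the (unique up to nonzero scalar) nonzero $\mathfrak{sl}(2,\mathbb{C})$-module morphism, normalized so that $[x,y]=\alpha(x\wedge y)$ is the anticommutative product with $[v_6,v_0]=20v_6$, $[v_6,v_{-2}]=10v_4$, $[v_6,v_{-4}]=4v_2$, $[v_6,v_{-6}]=v_0$, $[v_4,v_2]=-60v_6$, $[v_4,v_0]=-20v_4$, $[v_4,v_{-4}]=6v_0$, $[v_4,v_{-6}]=4v_{-2}$, $[v_2,v_0]=-20v_2$, $[v_2,v_{-2}]=-15v_0$, $[v_2,v_{-6}]=10v_{-4}$, $[v_0,v_{-2}]=-20v_{-2}$, $[v_0,v_{-4}]=-20v_{-4}$, $[v_0,v_{-6}]=20v_{-6}$,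 $[v_{-2},v_{-4}]=-60v_{-6}$, and all other products $[v_p,v_q]$ with $p>q$ equal to $0$. A polynomial identity of degree $\le n$ is a nonassociative polynomial over $\mathbb{C}$ of degree $\le n$ in the given operation which vanishes for all substitutions of elements of the algebra for the variables. An identity is a consequence of a set of identities if it is satisfied by every algebra over $\mathbb{C}$ (with an operation of the given kind) that satisfies all identities in the set. *)

(* Defs.v *)
From HB Require Import structures.
From mathcomp Require Import all_boot all_order all_algebra.
From mathcomp Require Import sesquilinear ring zify freeg.

Set Implicit Arguments.
Unset Strict Implicit.
Unset Printing Implicit Defensive.

Import Order.TTheory GRing.Theory Num.Theory.

Local Open Scope ring_scope.

Inductive naword : Type := Var of nat | Mul of naword & naword.

Fixpoint naword_encode (w : naword) : GenTree.tree nat :=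
  match w with
  | Var n => GenTree.Leaf n
  | Mul u v => GenTree.Node 0 [:: naword_encode u; naword_encode v]
  end.

Fixpoint naword_decode (t : GenTree.tree nat) : option naword :=
  match t with
  | GenTree.Leaf n => Some (Var n)
  | GenTree.Node 0 [:: s; t] =>
      match naword_decode s, naword_decode t with
      | Some u, Some v => Some (Mul u v)
      | _, _ => None
      end
  | _ => None
  end.

Lemma naword_encodeK : pcancel naword_encode naword_decode.
Proof. by elim=> //= u -> v ->. Qed.

HB.instance Definition _ := Equality.copy naword (pcan_type naword_encodeK).
HB.instance Definition _ := Choice.copy naword (pcan_type naword_encodeK).

Fixpoint word_degree (w : naword) : nat :=
  match w with
  | Var _ => 1
  | Mul u v => word_degree u + word_degree v
  end.

(* The free nonassociative algebra on countably many variables: it has *)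
(* no unit, hence no constant term.                                    *)
Notation napoly F := {freeg naword / F}.

Definition degree_le (F : fieldType) (n : nat) (f : napoly F) : Prop :=
  {in dom f, forall w, (word_degree w <= n)%N}.

Fixpoint word_eval (A : Type) (op : A -> A -> A) (x : nat -> A) (w : naword)
    : A :=
  match w with
  | Var n => x n
  | Mul u v => op (word_eval op x u) (word_eval op x v)
  end.

Definition poly_eval (F : fieldType) (A : lmodType F) (op : A -> A -> A)
    (x : nat -> A) (f : napoly F) : A :=
  fglift (word_eval op x) f.

Definition satisfies (F : fieldType) (A : lmodType F) (op : A -> A -> A)
    (f : napoly F) : Prop :=
  forall x : nat -> A, poly_eval op x f = 0.

Definition consequence (F : fieldType) (S : napoly F -> Prop) (f : napoly F)
    : Prop :=
  forall (A : lmodType F) (op : {bilinear A -> A -> A}),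
    (forall g, S g -> satisfies op g) -> satisfies op f.

Section MalcevIdentities.
Context (F : fieldType).
Local Notation a := (Var 0).
Local Notation b := (Var 1).
Local Notation c := (Var 2).
Local Notation d := (Var 3).
Local Notation "[[ x , y ]]" := (Mul x y).

Definition anticommutativity : napoly F := << [[a, b]] >> + << [[b, a]] >>.

Definition malcev_identity : napoly F :=
    << [[ [[ [[a, c]], b]], d]] >> + << [[ [[ [[d, a]], c]], b]] >>
  + << [[ [[ [[c, b]], d]], a]] >> + << [[ [[ [[b, d]], a]], c]] >>
  - << [[ [[a, b]], [[c, d]] ]] >>.

Definition malcev_identities (g : napoly F) : Prop :=
  g = anticommutativity \/ g = malcev_identity.

End MalcevIdentities.

(* Modules over sl(2), given by the action of the basis H, E, F with   *)
(* [H, E] = 2 E, [H, F] = - 2 F, [E, F] = H                            *)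

Record sl2module (K : numFieldType) := Sl2Module {
  sl2_carrier :> lmodType K;
  actH : {linear sl2_carrier -> sl2_carrier};
  actE : {linear sl2_carrier -> sl2_carrier};
  actF : {linear sl2_carrier -> sl2_carrier};
  _ : forall x, actH (actE x) - actE (actH x) = 2 *: actE x;
  _ : forall x, actH (actF x) - actF (actH x) = - 2 *: actF x;
  _ : forall x, actE (actF x) - actF (actE x) = actH x
}.

Arguments actH {K s}.
Arguments actE {K s}.
Arguments actF {K s}.

Definition sl2_morphism (K : numFieldType) (U V : sl2module K)
    (f : {linear U -> V}) : Prop :=
  forall x, [/\ f (actH x) = actH (f x),
                f (actE x) = actE (f x) & f (actF x) = actF (f x)].

Section V6.
Context (K : numFieldType).

(* The coordinate of index i is the one on v_{6-2i}; v p is 0 when p   *)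
(* is not a weight, in particular when p = 8 or p = -8.                *)
Definition v (p : int) : 'rV[K]_7 := \row_(i < 7) (p == 6 - 2 * i%:Z)%:R.

(* Row i is the image of v_{6-2i}; matrices act on the right of rows. *)
Definition matH : 'M[K]_7 := \matrix_i ((6 - 2 * i%:Z)%:~R *: v (6 - 2 * i%:Z)).
Definition matE : 'M[K]_7 :=
  \matrix_i ((7 - i%:Z)%:~R *: v (6 - 2 * (i%:Z - 1))).
Definition matF : 'M[K]_7 :=
  \matrix_i ((i%:Z + 1)%:~R *: v (6 - 2 * (i%:Z + 1))).

Lemma vE (i : 'I_7) : v (6 - 2 * i%:Z) = delta_mx 0 i.
Proof.
apply/rowP => j; rewrite !mxE eqxx /= -val_eqE /=; congr (_ %:R).
by apply: congr1; lia.
Qed.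

Variant weight_index_spec (q : int) : 'rV[K]_7 -> Type :=
  | WeightIndex (i : 'I_7) of q = i%:Z : weight_index_spec q (delta_mx 0 i)
  | NotWeightIndex of ~~ (0 <= q <= 6) : weight_index_spec q 0.

Lemma weight_indexP q : weight_index_spec q (v (6 - 2 * q)).
Proof.
case: (boolP (0 <= q <= 6)) => [q06|q06].
  have lt7 : (`|q| < 7)%N by lia.
  have -> : q = (Ordinal lt7)%:Z by rewrite /=; lia.
  by rewrite vE; constructor.
suff -> : v (6 - 2 * q) = 0 by constructor.
apply/rowP => j; rewrite !mxE; have := ltn_ord j.
by case: eqP => // ? ?; exfalso; lia.
Qed.

Lemma v_eq0 q : ~~ (0 <= q <= 6) -> v (6 - 2 * q) = 0.
Proof. by case: weight_indexP => // i ->; have := ltn_ord i; lia. Qed.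

Lemma v_matH q : v (6 - 2 * q) *m matH = (6 - 2 * q)%:~R *: v (6 - 2 * q).
Proof.
case Dq: _ / (weight_indexP q) => [i ->|]; last by rewrite mul0mx scaler0.
by rewrite -rowE rowK vE.
Qed.

Lemma v_matE q : v (6 - 2 * q) *m matE = (7 - q)%:~R *: v (6 - 2 * (q - 1)).
Proof.
case Dq: _ / (weight_indexP q) => [i ->|q06]; first by rewrite -rowE rowK.
rewrite mul0mx; have [->|q7] := eqVneq q 7; first by rewrite subrr scale0r.
by rewrite v_eq0 ?scaler0 //; lia.
Qed.

Lemma v_matF q : v (6 - 2 * q) *m matF = (q + 1)%:~R *: v (6 - 2 * (q + 1)).
Proof.
case Dq: _ / (weight_indexP q) => [i ->|q06]; first by rewrite -rowE rowK.
rewrite mul0mx; have [->|q7] := eqVneq q (- 1).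
  by rewrite addNr scale0r.
by rewrite v_eq0 ?scaler0 //; lia.
Qed.

Lemma matHE : matE *m matH - matH *m matE = 2 *: matE.
Proof.
apply/row_matrixP => i; rewrite !rowE mulmxBr !mulmxA -scalemxAr -vE.
rewrite v_matE v_matH -!scalemxAl v_matE v_matH !scalerA -scalerBl.
by congr (_ *: _); ring.
Qed.

Lemma matHF : matF *m matH - matH *m matF = - 2 *: matF.
Proof.
apply/row_matrixP => i; rewrite !rowE mulmxBr !mulmxA -scalemxAr -vE.
rewrite v_matF v_matH -!scalemxAl v_matF v_matH !scalerA -scalerBl.
by congr (_ *: _); ring.
Qed.

Lemma matEF : matF *m matE - matE *m matF = matH.
Proof.
apply/row_matrixP => i; rewrite !rowE mulmxBr !mulmxA -vE.
rewrite v_matF v_matE v_matH -!scalemxAl v_matF v_matE !scalerA.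
rewrite addrK subrK -scalerBl.
by congr (_ *: _); ring.
Qed.

Fact V6_HE x : mulmxr matH (mulmxr matE x) - mulmxr matE (mulmxr matH x)
  = 2 *: mulmxr matE x :> 'rV[K]_7.
Proof. by rewrite /= -!mulmxA -mulmxBr matHE -scalemxAr. Qed.

Fact V6_HF x : mulmxr matH (mulmxr matF x) - mulmxr matF (mulmxr matH x)
  = - 2 *: mulmxr matF x :> 'rV[K]_7.
Proof. by rewrite /= -!mulmxA -mulmxBr matHF -scalemxAr. Qed.

Fact V6_EF x : mulmxr matE (mulmxr matF x) - mulmxr matF (mulmxr matE x)
  = mulmxr matH x :> 'rV[K]_7.
Proof. by rewrite /= -!mulmxA -mulmxBr matEF. Qed.

Definition V6 : sl2module K := Sl2Module V6_HE V6_HF V6_EF.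

(* The exterior square, as the space of skew-symmetric matrices (valid *)
(* in characteristic 0); see ext2_universal.                           *)
Definition skew : {vspace 'M[K]_7} :=
  lker (linfun (fun M : 'M[K]_7 => M + M^T)).
Definition ext2 := subvs_of skew.

Lemma skewP (M : 'M[K]_7) : reflect (M^T = - M) (M \in skew).
Proof.
have lin : linear (fun M : 'M[K]_7 => M + M^T).
  by move=> c A B; rewrite linearP scalerDr addrACA.
pose f := GRing.isLinear.Build _ _ _ _ _ lin.
pose F : {linear 'M[K]_7 -> 'M[K]_7} := HB.pack (fun M : 'M[K]_7 => M + M^T) f.
rewrite memv_ker -[X in linfun X]/(F : _ -> _) lfunE /= addrC addr_eq0.
exact: eqP.
Qed.

Lemma ext2_tr (w : ext2) : (vsval w)^T = - vsval w.
Proof. exact/skewP/subvsP. Qed.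

Definition wedge (x y : 'rV[K]_7) : ext2 :=
  vsproj skew (x^T *m y - y^T *m x).

(* The derivation action X (x /\ y) = X x /\ y + x /\ X y, where X acts *)
(* on rows by x |-> x *m X; see ext2_act_wedge.                         *)
Definition ext2_act (X : 'M[K]_7) (w : ext2) : ext2 :=
  vsproj skew (X^T *m vsval w + vsval w *m X).

Fact ext2_act_is_linear X : linear (ext2_act X).
Proof.
move=> c w1 w2; rewrite /ext2_act -linearP; congr (vsproj _ _).
rewrite [vsval _]linearP mulmxDr mulmxDl -scalemxAr -scalemxAl scalerDr.
exact: addrACA.
Qed.

HB.instance Definition _ X :=
  GRing.isLinear.Build K ext2 ext2 _ (ext2_act X) (ext2_act_is_linear X).

Lemma val_wedge x y : vsval (wedge x y) = x^T *m y - y^T *m x.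
Proof.
by rewrite vsprojK //; apply/skewP; rewrite linearB /= !trmx_mul !trmxK opprB.
Qed.

Lemma val_ext2_act X w :
  vsval (ext2_act X w) = X^T *m vsval w + vsval w *m X.
Proof.
rewrite vsprojK //; apply/skewP.
by rewrite linearD /= !trmx_mul !trmxK ext2_tr mulmxN mulNmx opprD addrC.
Qed.

Lemma ext2_act_wedge X x y :
  ext2_act X (wedge x y) = wedge (x *m X) y + wedge x (y *m X).
Proof.
apply/val_inj; rewrite linearD /= val_ext2_act !val_wedge.
rewrite mulmxBr mulmxBl !trmx_mul !mulmxA addrACA.
by rewrite [RHS]addrACA; congr (_ + _); rewrite addrC.
Qed.

Lemma ext2_act_comm X Y w :
  ext2_act X (ext2_act Y w) - ext2_act Y (ext2_act X w)
  = ext2_act (Y *m X - X *m Y) w.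
Proof.
apply/val_inj; rewrite linearB /= !val_ext2_act.
rewrite !mulmxDr !mulmxDl !mulmxA linearB /= !trmx_mul mulmxBl.
rewrite mulmxN !mulmxA.
set A := _ *m Y^T *m _; set B := _ *m Y; set C := _ *m X^T *m _.
set E := _ *m _ *m X; set D := _ *m Y *m X; set G := _ *m X *m Y.
have -> : A + B + (E + D) = A + D + (B + E) by rewrite [E + D]addrC addrACA.
have -> : C + E + (B + G) = C + G + (B + E).
  by rewrite [B + G]addrC addrACA [E + B]addrC.
by rewrite [C + G + _]addrC addrKA [RHS]addrACA opprD.
Qed.

Fact ext2_HE w : ext2_act matH (ext2_act matE w)
  - ext2_act matE (ext2_act matH w) = 2 *: ext2_act matE w.
Proof.
rewrite ext2_act_comm matHE; apply/val_inj; rewrite linearZ /= !val_ext2_act.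
by rewrite linearZ /= -scalemxAl -scalemxAr scalerDr.
Qed.

Fact ext2_HF w : ext2_act matH (ext2_act matF w)
  - ext2_act matF (ext2_act matH w) = - 2 *: ext2_act matF w.
Proof.
rewrite ext2_act_comm matHF; apply/val_inj; rewrite linearZ /= !val_ext2_act.
by rewrite linearZ /= -scalemxAl -scalemxAr scalerDr.
Qed.

Fact ext2_EF w : ext2_act matE (ext2_act matF w)
  - ext2_act matF (ext2_act matE w) = ext2_act matH w.
Proof. by rewrite ext2_act_comm matEF. Qed.

Definition ext2_V6 : sl2module K := Sl2Module ext2_HE ext2_HF ext2_EF.

Lemma ext2_decomp (w : ext2) :
  w = 2^-1 *: \sum_i \sum_j vsval w i j *: wedge (delta_mx 0 i) (delta_mx 0 j).
Proof.
apply/val_inj; rewrite linearZ linear_sum /=.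
under eq_bigr => i _.
  rewrite linear_sum /=.
  under eq_bigr => j _.
    rewrite val_wedge !trmx_delta !mul_delta_mx scalerBr; over.
  rewrite sumrB; over.
rewrite sumrB -matrix_sum_delta.
have -> : \sum_i \sum_j vsval w i j *: delta_mx j i = (vsval w)^T.
  rewrite [RHS]matrix_sum_delta exchange_big.
  by apply: eq_bigr => i _; apply: eq_bigr => j _; rewrite mxE.
by rewrite ext2_tr opprK -mulr2n -scaler_nat scalerA mulVf ?scale1r ?pnatr_eq0.
Qed.

Lemma ext2_universal (U : lmodType K) (f : {bilinear 'rV[K]_7 -> 'rV[K]_7 -> U}) :
    (forall x, f x x = 0) ->
  exists2 g : {linear ext2 -> U}, forall x y, g (wedge x y) = f x y &
    forall g' : {linear ext2 -> U},
      (forall x y, g' (wedge x y) = f x y) -> g' =1 g.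
Proof.
move=> f_alt.
have fC x y : f y x = - f x y.
  have := f_alt (x + y); rewrite linearDl !linearD /= !f_alt addr0 add0r.
  by move/eqP; rewrite addrC addr_eq0 => /eqP.
pose G (w : ext2) : U :=
  2^-1 *: \sum_i \sum_j vsval w i j *: f (delta_mx 0 i) (delta_mx 0 j).
have G_lin : linear G.
  move=> c w1 w2; rewrite /G scalerA mulrC -scalerA -scalerDr; congr (_ *: _).
  rewrite scaler_sumr -big_split; apply: eq_bigr => i _ /=.
  rewrite scaler_sumr -big_split; apply: eq_bigr => j _ /=.
  by rewrite !mxE scalerDl scalerA.
pose g : {linear ext2 -> U} :=
  HB.pack G (GRing.isLinear.Build K ext2 U *:%R G G_lin).
have fE x y : f x y =
    \sum_i \sum_j (x 0 i * y 0 j) *: f (delta_mx 0 i) (delta_mx 0 j).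
  rewrite {1}(row_sum_delta x) {1}(row_sum_delta y) linear_sumlz.
  apply: eq_bigr => i _; rewrite linear_sumr; apply: eq_bigr => j _ /=.
  by rewrite linearZl_LR linearZr_LR scalerA.
exists g => [x y|g' g'E w] /=.
  rewrite /G val_wedge.
  have -> : \sum_i \sum_j (x^T *m y - y^T *m x) i j *:
      f (delta_mx 0 i) (delta_mx 0 j) = f x y - f y x.
    rewrite !fE -sumrB; apply: eq_bigr => i _.
    rewrite -sumrB; apply: eq_bigr => j _.
    by rewrite -scalerBl !mxE !big_ord1 !mxE.
  by rewrite (fC x y) opprK -mulr2n -scaler_nat scalerA mulVf ?scale1r ?pnatr_eq0.
rewrite {1}(ext2_decomp w) linearZ linear_sum /= /G; congr (_ *: _).
apply: eq_bigr => i _; rewrite linear_sum; apply: eq_bigr => j _ /=.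
by rewrite linearZ /= g'E.
Qed.

Definition bracket (alpha : {linear ext2_V6 -> V6}) (x y : 'rV[K]_7)
  : 'rV[K]_7 := alpha (wedge x y).

Definition product_table : seq ((int * int) * (int * int)) := [::
  ((6, 0), (20, 6)); ((6, -2), (10, 4)); ((6, -4), (4, 2)); ((6, -6), (1, 0));
  ((4, 2), (-60, 6)); ((4, 0), (-20, 4)); ((4, -4), (6, 0));
  ((4, -6), (4, -2)); ((2, 0), (-20, 2)); ((2, -2), (-15, 0));
  ((2, -6), (10, -4)); ((0, -2), (-20, -2)); ((0, -4), (-20, -4));
  ((0, -6), (20, -6)); ((-2, -4), (-60, -6)) ].

(* [v_p, v_q] = c v_r for the entries ((p, q), (c, r)) of product_table and *)
(* [v_p, v_q] = 0 for the other weights p > q.                          *)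
Definition normalized (mu : 'rV[K]_7 -> 'rV[K]_7 -> 'rV[K]_7) : Prop :=
  (forall p q c r, ((p, q), (c, r)) \in product_table ->
     mu (v p) (v q) = c%:~R *: v r) /\
  (forall p q, q < p -> (p, q) \notin [seq e.1 | e <- product_table] ->
     mu (v p) (v q) = 0).

End V6.


Section Existence.
Context (K : numFieldType).

Local Definition o (k : nat) : 'I_7 := inord k.

Definition V6_product (x y : 'rV[K]_7) : 'rV[K]_7 :=
  let X i j := x 0 (o i) * y 0 (o j) - x 0 (o j) * y 0 (o i) in
  \row_k [:: 20 * X 0 3 - 60 * X 1 2; 10 * X 0 4 - 20 * X 1 3;
             4 * X 0 5 - 20 * X 2 3; X 0 6 + 6 * X 1 5 - 15 * X 2 4;
             4 * X 1 6 - 20 * X 3 4; 10 * X 2 6 - 20 * X 3 5;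
             20 * X 3 6 - 60 * X 4 5]`_k.

Let mu_bilinear : bilinear_for *:%R *:%R V6_product.
Proof.
split=> u c x y; apply/rowP => k; rewrite !mxE;
  case: k => [[|[|[|[|[|[|[|//]]]]]]] ?]; rewrite /=; ring.
Qed.

HB.instance Definition _ :=
  bilinear_isBilinear.Build K 'rV[K]_7 'rV[K]_7 'rV[K]_7 *:%R *:%R V6_product
    mu_bilinear.

Let mu_alt x : V6_product x x = 0.
Proof.
apply/rowP => k; rewrite !mxE;
  case: k => [[|[|[|[|[|[|[|//]]]]]]] ?]; rewrite /=; ring.
Qed.

Let ordP (k : 'I_7) : exists2 m, (m < 7)%N & k = o m.
Proof. by exists k; rewrite ?ltn_ord // /o inord_val. Qed.

Let muC x y m : (m < 7)%N -> V6_product x y 0 (o m) =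
  let X i j := x 0 (o i) * y 0 (o j) - x 0 (o j) * y 0 (o i) in
  [:: 20 * X 0 3 - 60 * X 1 2; 10 * X 0 4 - 20 * X 1 3;
      4 * X 0 5 - 20 * X 2 3; X 0 6 + 6 * X 1 5 - 15 * X 2 4;
      4 * X 1 6 - 20 * X 3 4; 10 * X 2 6 - 20 * X 3 5;
      20 * X 3 6 - 60 * X 4 5]`_m.
Proof. by move=> lt7; rewrite mxE /= inordK. Qed.

Let xH (x : 'rV[K]_7) m : (m < 7)%N ->
  (x *m matH K) 0 (o m) = (6 - 2 * m%:R) * x 0 (o m).
Proof.
move=> lt7; rewrite mxE (bigD1 (o m)) //= big1 => [|i neq].
  by rewrite !mxE eqxx /= /o inordK //; ring.
rewrite !mxE; case: eqP => [eq|_]; last by rewrite !mulr0.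
by case/eqP: neq; apply/val_inj; move: eq; rewrite /= /o inordK //; lia.
Qed.

Let xE (x : 'rV[K]_7) m : (m < 7)%N ->
  (x *m matE K) 0 (o m) = (6 - m%:R) * x 0 (o m.+1).
Proof.
move=> lt7; have [eq6|neq6] := eqVneq m 6.
  rewrite eq6 subrr mul0r mxE big1 // => i _; rewrite !mxE /o inordK //.
  by case: eqP => [eq|_]; rewrite ?mulr0 //; exfalso; have := ltn_ord i; lia.
have ltS : (m.+1 < 7)%N by lia.
rewrite mxE (bigD1 (o m.+1)) //= big1 => [|i neq].
  rewrite !mxE /o !inordK //.
  have -> : (6 - 2 * (m.+1%:Z - 1) == 6 - 2 * m%:Z) by apply/eqP; lia.
  have -> : 7 - m.+1%:Z = 6 - m%:Z by lia.
  by rewrite /=; ring.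
rewrite !mxE; case: eqP => [eq|_]; last by rewrite !mulr0.
by case/eqP: neq; apply/val_inj; move: eq; rewrite /= /o !inordK //; lia.
Qed.

Let xF (x : 'rV[K]_7) m : (m < 7)%N ->
  (x *m matF K) 0 (o m) = m%:R * x 0 (o m.-1).
Proof.
case: m => [_|m lt7].
  rewrite mul0r mxE big1 // => i _; rewrite !mxE /o inordK //.
  by case: eqP => [eq|_]; rewrite ?mulr0 //; exfalso; lia.
rewrite mxE (bigD1 (o m)) //= big1 => [|i neq].
  rewrite !mxE /o !inordK //; last by lia.
  have -> : (6 - 2 * (m%:Z + 1) == 6 - 2 * m.+1%:Z) by apply/eqP; lia.
  by rewrite mulrS /=; ring.
rewrite !mxE; case: eqP => [eq|_]; last by rewrite !mulr0.
by case/eqP: neq; apply/val_inj; move: eq; rewrite /= /o !inordK //; lia.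
Qed.

Let mu_H x y : V6_product x y *m matH K = V6_product (x *m matH K) y + V6_product x (y *m matH K).
Proof.
apply/rowP => k; have [m lt7 ->] := ordP k; rewrite [RHS]mxE xH // !muC //.
by move: m lt7; do 7?[case=> [_|]; first by rewrite /= !xH //; ring].
Qed.

Let mu_E x y : V6_product x y *m matE K = V6_product (x *m matE K) y + V6_product x (y *m matE K).
Proof.
apply/rowP => k; have [m lt7 ->] := ordP k; rewrite [RHS]mxE xE //.
have [->|neq6] := eqVneq m 6.
  by rewrite subrr mul0r !muC //= !xE //; ring.
rewrite !muC //; last by lia.
by move: m lt7 neq6; do 7?[case=> [_ _|]; first by rewrite /= !xE //; ring].
Qed.

Let mu_F x y : V6_product x y *m matF K = V6_product (x *m matF K) y + V6_product x (y *m matF K).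
Proof.
apply/rowP => k; have [m lt7 ->] := ordP k; rewrite [RHS]mxE xF // !muC //.
  by move: m lt7; do 7?[case=> [_|]; first by rewrite /= !xF //; ring].
by lia.
Qed.

Let v_o p m : (m < 7)%N -> v K p 0 (o m) = (p == 6 - 2 * m%:Z)%:R.
Proof. by move=> lt7; rewrite mxE /o inordK. Qed.

Let v_weight p :
  p \in [:: 6; 4; 2; 0; -2; -4; -6] \/ v K p = 0.
Proof.
have [|np] := boolP (p \in _); [by left | right].
apply/rowP => k; rewrite !mxE; case: eqP => // eq; case/negP: np.
by rewrite {p}eq; case: k; do 7?[case=> //].
Qed.

(* The hypotheses made on alpha are consistent. *)
Lemma alpha_exists :
  exists2 alpha : {linear ext2_V6 K -> V6 K},
    sl2_morphism alpha & normalized (bracket alpha).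
Proof.
have [alpha alphaE _] := ext2_universal mu_alt.
have act X : (forall x y, V6_product x y *m X = V6_product (x *m X) y + V6_product x (y *m X)) ->
    forall w, alpha (ext2_act X w) = alpha w *m X.
  move=> muX w; rewrite (ext2_decomp w) !linearZ !linear_sum /=.
  rewrite -scalemxAl mulmx_suml; congr (_ *: _); apply: eq_bigr => i _.
  rewrite !linear_sum mulmx_suml; apply: eq_bigr => j _.
  by rewrite !linearZ /= ext2_act_wedge linearD /= !alphaE -muX -scalemxAl.
have mu_vE p q r (c : int) :
    (forall m, (m < 7)%N -> V6_product (v K p) (v K q) 0 (o m) =
      c%:~R * (r == 6 - 2 * m%:Z)%:R) ->
    V6_product (v K p) (v K q) = c%:~R *: v K r.
  move=> eq; apply/rowP => k; have [m lt7 ->] := ordP k.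
  by rewrite eq // mxE v_o.
exists alpha; first by move=> w; split; apply: act.
split=> [p q c r|p q ltqp notin]; rewrite /bracket alphaE.
  by rewrite !inE; do ?[case/orP]; case/eqP=> -> -> -> ->; apply: mu_vE;
    do 7?[case=> [_|]; first by rewrite muC //= !v_o //=; ring].
have [|->] := v_weight p; last by rewrite linear0l.
have [|->] := v_weight q; last by rewrite linear0r.
rewrite !inE; do ?[case/orP]; move=> /eqP eqq; do ?[case/orP];
  move=> /eqP eqp; move: ltqp notin; rewrite eqp eqq // => _ _;
  rewrite -(scale0r (v K 0)); apply: (mu_vE _ _ 0 0);
  by do 7?[case=> [_|]; first by rewrite muC //= !v_o //=; ring].
Qed.

End Existence.

(* Main.v *)
From HB Require Import structures.
Require Import Defs.
From mathcomp Require Import all_boot all_order all_algebra.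
From mathcomp Require Import sesquilinear zify reals complex freeg.

(** Why the theorem holds.  In characteristic 0 a polynomial identity is
    equivalent to the multilinear identities obtained by polarizing its
    homogeneous components.  So it is enough to show, for n <= 4, that every
    multilinear identity of degree n of V(6) holds in every Malcev algebra A;
    the reduction to this case is [inherits_identities].

    For the multilinear case, A is compared with V(6) by means of finitely many
    evaluations.  In a basis of weight vectors of V(6), rescaled so that the
    structure constants are 0, 1, -1, 2 or -2, a multilinear word u evaluated
    at basis vectors is an integer T(u) times a basis vector.  For suitable
    choices t of basis vectors, with integers T_t(u), there are multilinear
    functions z_t on A such that, for all multilinear u of degree n,

      D u(y) = sum over t of T_t(u) z_t(y)

    with a nonzero integer D ([factorization]): the values of words in A depend
    on their values in V(6) only.  If a combination of words vanishes on V(6),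
    all the numbers T_t of this combination are 0, hence it vanishes on A.

    The formula comes from a computation in the space spanned by the words
    modulo anticommutativity, which has dimension 1, 1, 3, 15 in degrees 1, 2,
    3, 4.  Give it the scalar product for which the normal words form an
    orthonormal basis.  In degree 4, the Malcev relations span a subspace of
    dimension 5, and the evaluations T_t span its orthogonal complement: this
    equality of spaces is the mathematical content of the theorem.  It is
    expressed by a Gram identity: for positive integers w_t,

      sum of w_t T_t^T T_t + 27 (sum of rho^T rho) = 648 Id

    for row vectors T_t and rho, where t runs through the rearrangements of
    four choices of basis vectors and rho through the Malcev relations obtained
    by permuting the variables.  Applying both sides to words and evaluating in
    A, where every rho is 0, gives the factorization with D = 648.  In degrees
    1, 2 and 3 there are no Malcev relations, and the operators T_t^T T_t alone
    have a combination that is scalar. *)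

Set Implicit Arguments.
Unset Strict Implicit.
Unset Printing Implicit Defensive.

Import Order.TTheory GRing.Theory Num.Theory.

Local Open Scope ring_scope.

(** * Words, renamings and fillings *)

Fixpoint letters (w : naword) : seq nat :=
  match w with
  | Var i => [:: i]
  | Mul u v => letters u ++ letters v
  end.

Fixpoint rename (k : nat -> nat) (w : naword) : naword :=
  match w with
  | Var i => Var (k i)
  | Mul u v => Mul (rename k u) (rename k v)
  end.

Fixpoint fillings (J : seq nat) (w : naword) : seq naword :=
  match w with
  | Var _ => map Var J
  | Mul u v => [seq Mul a b | a <- fillings J u, b <- fillings J v]
  end.

Definition multilinear (n : nat) (w : naword) : bool :=
  perm_eq (letters w) (iota 0 n).

Lemma size_letters w : size (letters w) = word_degree w.
Proof. by elim: w => //= u IHu v IHv; rewrite size_cat IHu IHv. Qed.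

Lemma word_degree_gt0 w : (0 < word_degree w)%N.
Proof. by elim: w => //= u IHu v _; rewrite ltn_addr. Qed.

Lemma multilinear_degree n w : multilinear n w -> word_degree w = n.
Proof. by move/perm_size; rewrite size_letters size_iota. Qed.

Lemma Var_eq i j : (Var i == Var j) = (i == j).
Proof. by apply/eqP/eqP => [[]|->]. Qed.

Lemma Mul_eq a b u v : (Mul a b == Mul u v) = (a == u) && (b == v).
Proof. by apply/eqP/andP => [[-> ->]|[/eqP-> /eqP->]]. Qed.

Lemma fillings_degree J u w :
  u \in fillings J w -> word_degree u = word_degree w.
Proof.
elim: w u => [i|w1 IH1 w2 IH2] u /=; first by case/mapP=> j _ ->.
by case/allpairsP=> -[a b] /= [/IH1 <- /IH2 <- ->].
Qed.

Lemma rename_fillings J k u w : u \in fillings J w ->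
  (rename k u == w) = (map k (letters u) == letters w).
Proof.
elim: w u => [i|w1 IH1 w2 IH2] u /=.
  by case/mapP=> j _ -> /=; rewrite Var_eq eqseq_cons andbT.
case/allpairsP=> -[a b] /= [Ja Jb ->] /=.
rewrite Mul_eq map_cat eqseq_cat ?IH1 ?IH2 //.
by rewrite size_map !size_letters (fillings_degree Ja).
Qed.

Fixpoint all_seqs (J : seq nat) (d : nat) : seq (seq nat) :=
  if d is d'.+1 then [seq j :: s | j <- J, s <- all_seqs J d'] else [:: [::]].

Lemma all_seqsD J d1 d2 : all_seqs J (d1 + d2) =
  [seq s ++ t | s <- all_seqs J d1, t <- all_seqs J d2].
Proof.
elim: d1 => [|d1 IH]; first by rewrite /= cats0 map_id.
rewrite addSn /= IH; move: (all_seqs J d1) (all_seqs J d2) => S1 S2.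
elim: {IH} J => //= j J ->.
rewrite allpairs_cat; congr (_ ++ _).
by rewrite allpairs_mapl map_allpairs.
Qed.

Lemma letters_fillings J w :
  map letters (fillings J w) = all_seqs J (word_degree w).
Proof.
elim: w => [i|u IHu v IHv] /=.
  by rewrite -map_comp; elim: J => //= j J ->.
by rewrite all_seqsD -IHu -IHv allpairs_mapl allpairs_mapr map_allpairs.
Qed.

Lemma mem_all_seqs J s : {subset s <= J} -> s \in all_seqs J (size s).
Proof.
elim: s => //= j s IH sJ; apply/allpairsP; exists (j, s); split=> //=.
  by rewrite sJ ?mem_head.
by apply: IH => i si; rewrite sJ // inE si orbT.
Qed.

(** This is n!, in a form that makes it plain that all words of degree n have
    the same number of multilinear fillings. *)
Definition multilinear_count n : nat :=
  count (perm_eq^~ (iota 0 n)) (all_seqs (iota 0 n) n).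

Lemma multilinear_count_gt0 n : (0 < multilinear_count n)%N.
Proof.
rewrite -has_count; apply/hasP; exists (iota 0 n) => //.
by have := @mem_all_seqs _ (iota 0 n) (fun _ => id); rewrite size_iota.
Qed.

Lemma count_multilinear n w : word_degree w = n ->
  count (multilinear n) (fillings (iota 0 n) w) = multilinear_count n.
Proof.
move=> Dn; rewrite /multilinear_count -[X in all_seqs _ X]Dn.
by rewrite -letters_fillings count_map.
Qed.

(** * Linearization of identities *)

Section Evaluation.
Context (K : numFieldType) (A : lmodType K) (op : {bilinear A -> A -> A}).

Lemma eq_word_eval x y w : {in letters w, x =1 y} ->
  word_eval op x w = word_eval op y w.
Proof.
elim: w => /= [i|u IHu v IHv] eq_xy; first by rewrite eq_xy ?mem_head.
by rewrite IHu ?IHv // => i wi; apply: eq_xy; rewrite mem_cat wi ?orbT.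
Qed.

Lemma word_eval_rename k x w :
  word_eval op x (rename k w) = word_eval op (x \o k) w.
Proof. by elim: w => //= u -> v ->. Qed.

Lemma word_eval_eq0 x w j : j \in letters w -> x j = 0 ->
  word_eval op x w = 0.
Proof.
move=> wj xj0; elim: w wj => /= [i|u IHu v IHv].
  by rewrite inE => /eqP <-.
by rewrite mem_cat => /orP[/IHu|/IHv] ->; rewrite ?linear0l ?linear0r.
Qed.

(** Expanding a word at sums: each letter i of w is replaced independently by
    some j with k j = i, and the fillings renamed to w by k record these
    choices. *)
Lemma word_eval_sum J k e w :
  word_eval op (fun i => \sum_(j <- J | k j == i) e j) w =
  \sum_(u <- fillings J w | rename k u == w) word_eval op e u.
Proof.
elim: w => [i|w1 IH1 w2 IH2] /=.
  by rewrite big_map /=; apply: eq_bigl => j; rewrite Var_eq.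
rewrite IH1 IH2 linear_sumlz /= big_mkcond [RHS]big_mkcond big_allpairs_dep.
apply: eq_bigr => a _ /=; rewrite linear_sumr /= big_mkcond.
case: ifP => ka.
  by apply: eq_bigr => b _; rewrite Mul_eq ka.
by rewrite big1 // => b _; rewrite Mul_eq ka.
Qed.

(** A polynomial is given here by a list of coefficients and words, possibly
    with repetitions, as produced by polarization. *)
Definition vanishes (r : seq (K * naword)) : Prop :=
  forall x, \sum_(p <- r) p.1 *: word_eval op x p.2 = 0.

End Evaluation.

(** The multilinear part in e_0, ..., e_(n-1) of the polynomial evaluated at
    x_i = sum of the e_j such that k j = i.  Letting k vary, these polynomials
    capture the part of degree n, see top_degree_vanishes. *)
Definition polarization (K : Type) (k : nat -> nat) n (r : seq (K * naword)) :=
  [seq (p.1, u) | p <- r, u <- [seq u <- fillings (iota 0 n) p.2 |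
                                  (rename k u == p.2) && multilinear n u]].

(** The words in which e_0, ..., e_(m-1) all occur are isolated by induction on
    m: subtracting the identity at e with e_m replaced by 0 removes exactly the
    words where e_m does not occur.  For m = n, a word of degree at most n in
    which all of e_0, ..., e_(n-1) occur is multilinear. *)
Lemma polarization_vanishes (K : numFieldType) (A : lmodType K)
    (op : {bilinear A -> A -> A}) k n r :
  {in r, forall p, (word_degree p.2 <= n)%N} ->
  vanishes op r -> vanishes op (polarization k n r).
Proof.
move=> deg_r r0 e.
pose part (m : nat) (e : nat -> A) := \sum_(p <- r) p.1 *:
  \sum_(u <- fillings (iota 0 n) p.2 |
     (rename k u == p.2) && all (mem (letters u)) (iota 0 m)) word_eval op e u.
have part0 m : forall e', part m e' = 0.
  elim: m => [|m IHm] {}e.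
    rewrite -[RHS](r0 (fun i => \sum_(j <- iota 0 n | k j == i) e j)).
    apply: eq_bigr => p _; rewrite word_eval_sum; congr (_ *: _).
    by apply: eq_bigl => u; rewrite andbT.
  pose e' j := if j == m then 0 else e j.
  rewrite -[RHS](subrr 0) -{1}(IHm e) -(IHm e') -sumrB.
  apply: eq_bigr => p _; rewrite -scalerBr -sumrB; congr (_ *: _).
  rewrite (eq_bigl (fun u => ((rename k u == p.2) &&
    all (mem (letters u)) (iota 0 m)) && (m \in letters u))); last first.
    by move=> u; rewrite -{1}addn1 iotaD all_cat /= add0n andbT andbA.
  rewrite big_mkcondr; apply: eq_bigr => u _; case: ifPn => um.
    by rewrite (@word_eval_eq0 _ _ op e' _ _ um) ?subr0 // /e' eqxx.
  rewrite (@eq_word_eval _ _ op e' e) ?subrr // => j uj.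
  by rewrite /e'; case: eqP => // jm; rewrite -jm uj in um.
rewrite big_allpairs_dep -[RHS](part0 n e) /part.
rewrite big_seq [in RHS]big_seq; apply: eq_bigr => p rp.
rewrite -scaler_sumr big_filter; congr (_ *: _).
rewrite big_seq_cond [RHS]big_seq_cond; apply: eq_bigl => u.
case Ju: (u \in _) => //=; congr (_ && _); apply/idP/allP => [ml i|sub].
  by rewrite -(perm_mem ml).
have sz : (size (letters u) <= size (iota 0 n))%N.
  by rewrite size_iota size_letters (fillings_degree Ju) deg_r.
have [_ eq_mem] := uniq_min_size (iota_uniq 0 n) sub sz.
apply: uniq_perm => [||i]; last by rewrite eq_mem.
  exact: leq_size_uniq (iota_uniq 0 n) sub sz.
exact: iota_uniq.
Qed.

(** A renaming of the letters below n+1 that is bounded by N, presented as an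
    element of a finite type so as to sum over all of them. *)
Definition renaming n N (k : {ffun 'I_n.+1 -> 'I_N.+1}) (j : nat) : nat :=
  k (inord j).

(** In a multilinear filling of w each letter j < n+1 occurs once, and k j must
    be the letter of w at this place. *)
Lemma renaming_unique n N u w : u \in fillings (iota 0 n.+1) w ->
    multilinear n.+1 u -> {in letters w, forall i, (i < N.+1)%N} ->
  exists k0, forall k : {ffun 'I_n.+1 -> 'I_N.+1},
    (rename (renaming k) u == w) = (k == k0).
Proof.
move=> Ju ml wN; pose i0 (j : nat) := index j (letters u).
have sz_u : size (letters u) = n.+1 by rewrite (perm_size ml) size_iota.
have sz_w : size (letters w) = n.+1.
  by rewrite -sz_u !size_letters (fillings_degree Ju).
have mem_u (j : 'I_n.+1) : (j : nat) \in letters u.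
  by rewrite (perm_mem ml) mem_iota ltn_ord.
have uniq_u : uniq (letters u) by rewrite (perm_uniq ml) iota_uniq.
exists [ffun j : 'I_n.+1 => inord (nth 0%N (letters w) (i0 j))] => k.
rewrite (rename_fillings _ Ju); apply/eqP/eqP => [eq_w|->].
  apply/ffunP => j; rewrite ffunE -eq_w (nth_map 0%N) ?index_mem //.
  by rewrite nth_index // /renaming !inord_val.
apply: (@eq_from_nth _ 0%N) => [|i]; rewrite size_map sz_u // => lt_i.
rewrite (nth_map 0%N) ?sz_u // /renaming ffunE.
have lt_u : (nth 0%N (letters u) i < n.+1)%N.
  by have := mem_nth 0%N (etrans (congr1 _ sz_u) lt_i);
     rewrite (perm_mem ml) mem_iota.
rewrite (inordK lt_u) /i0 index_uniq ?sz_u // inordK //.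
by apply: wN; rewrite mem_nth ?sz_w.
Qed.

Definition inherits_multilinear_identities (K : numFieldType) (V A : lmodType K)
    (opV : {bilinear V -> V -> V}) (opA : {bilinear A -> A -> A}) n : Prop :=
  forall r, {in r, forall p, multilinear n p.2} ->
    vanishes opV r -> vanishes opA r.

(** Polarization can be undone: among the pairs of a multilinear filling u of w
    and a renaming k such that k maps u to w, each u occurs once, so summing
    the values of u at x o k over all k gives n! times the value of w at x. *)
Lemma top_degree_vanishes (K : numFieldType) (V A : lmodType K)
    (opV : {bilinear V -> V -> V}) (opA : {bilinear A -> A -> A}) n
    (r : seq (K * naword)) :
    inherits_multilinear_identities opV opA n ->
    {in r, forall p, (word_degree p.2 <= n)%N} -> vanishes opV r ->
  vanishes opA [seq p <- r | word_degree p.2 == n].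
Proof.
case: n => [|n] VA deg_r r0 x.
  by rewrite big_filter big1 // => p; rewrite -leqn0 leqNgt word_degree_gt0.
have [N ltN] : exists N,
    {in r, forall p, {in letters p.2, forall i, (i < N.+1)%N}}.
  pose M (p : K * naword) := (\max_(i <- letters p.2) i)%N.
  exists (\max_(p <- r) M p)%N => p rp i pi.
  rewrite ltnS (leq_trans _ (leq_bigmax_seq _ rp isT)) //.
  exact: (leq_bigmax_seq _ pi isT).
have c_neq0 : (multilinear_count n.+1)%:R != 0 :> K.
  by rewrite pnatr_eq0 -lt0n multilinear_count_gt0.
apply: (scalerI c_neq0); rewrite scaler0 big_filter scaler_sumr.
transitivity (\sum_(k : {ffun 'I_n.+1 -> 'I_N.+1})
    \sum_(p <- polarization (renaming k) n.+1 r)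
      p.1 *: word_eval opA (x \o renaming k) p.2); last first.
  apply: big1 => k _; apply: VA; last exact: polarization_vanishes.
  move=> q /allpairsPdep[p [u [_]]].
  by rewrite mem_filter => /andP[/andP[_ ?] _] ->.
under [RHS]eq_bigr do rewrite big_allpairs_dep.
rewrite [RHS]exchange_big big_mkcond big_seq [RHS]big_seq.
apply: eq_bigr => p rp /=.
under [RHS]eq_bigr do rewrite big_filter -scaler_sumr big_mkcond.
rewrite -scaler_sumr exchange_big /=.
case: eqP => deg_p; last first.
  rewrite big_seq big1 ?scaler0 // => u Ju; apply: big1 => k _.
  by case: andP => // -[_ /multilinear_degree]; rewrite (fillings_degree Ju).
rewrite scalerA mulrC -scalerA; congr (_ *: _).
rewrite -(count_multilinear deg_p) -sum1_count natr_sum scaler_suml.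
rewrite big_mkcond big_seq [RHS]big_seq; apply: eq_bigr => u Ju /=.
case: (boolP (multilinear n.+1 u)) => ml; last first.
  by apply/esym/big1 => k _; rewrite andbF.
have [k0 k0P] := renaming_unique Ju ml (ltN p rp).
under eq_bigr do rewrite andbT.
rewrite -big_mkcond (big_pred1 k0) //= scale1r -word_eval_rename.
by congr word_eval; apply/esym/eqP; rewrite k0P.
Qed.

(** Descending induction on the degree.  To remove the part of top degree, one
    needs that it vanishes on V as well, and this is the case A = V of
    top_degree_vanishes. *)
Theorem inherits_identities (K : numFieldType) (V A : lmodType K)
    (opV : {bilinear V -> V -> V}) (opA : {bilinear A -> A -> A}) N
    (r : seq (K * naword)) :
    (forall n, (n <= N)%N -> inherits_multilinear_identities opV opA n) ->
    {in r, forall p, (word_degree p.2 <= N)%N} ->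
  vanishes opV r -> vanishes opA r.
Proof.
elim: N r => [|N IHN] r VA deg_r r0 x.
  by rewrite big_seq big1 // => p /deg_r; rewrite leqNgt word_degree_gt0.
have splitr (B : lmodType K) (op : {bilinear B -> B -> B}) y :
    \sum_(p <- r) p.1 *: word_eval op y p.2 =
    \sum_(p <- [seq p <- r | word_degree p.2 == N.+1]) p.1 *: word_eval op y p.2
  + \sum_(p <- [seq p <- r | word_degree p.2 != N.+1]) p.1 *: word_eval op y p.2.
  by rewrite !big_filter; apply: bigID.
rewrite splitr (top_degree_vanishes (VA _ _) deg_r r0) // add0r.
apply: IHN => [n leN|p|y]; first by apply: VA; rewrite leqW.
  by rewrite mem_filter => /andP[neqN /deg_r]; rewrite leq_eqVlt (negPf neqN).
by have := r0 y; rewrite splitr (top_degree_vanishes _ deg_r r0) ?add0r.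
Qed.

(** * Normal words modulo anticommutativity *)

(** The words of degree d with letters in J; the height bound h makes the
    recursion structural, and h = d is enough. *)
Fixpoint words (J : seq nat) (h d : nat) : seq naword :=
  if h is h'.+1 then
    if d == 1 then map Var J else
    flatten [seq [seq Mul u v | u <- words J h' i, v <- words J h' (d - i)]
            | i <- iota 1 d.-1]
  else [::].

Lemma mem_words J h w : (word_degree w <= h)%N -> {subset letters w <= J} ->
  w \in words J h (word_degree w).
Proof.
elim: h w => [|h IH] [i|u v] //= le_h wJ.
- by move: le_h; rewrite leqn0 addn_eq0 eqn0Ngt word_degree_gt0.
- by rewrite map_f // wJ ?mem_head.
have u0 := word_degree_gt0 u; have v0 := word_degree_gt0 v.
case: eqP => [|_]; first by lia.
apply/flatten_mapP; exists (word_degree u); first by rewrite mem_iota; lia.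
rewrite addKn allpairs_f //; apply: IH; try lia; move=> i wi.
  by rewrite wJ // mem_cat wi.
by rewrite wJ // mem_cat wi orbT.
Qed.

(** The order in which the factors of a normal word are written: the larger
    degree first, then the smaller leftmost letter.  It is total on words
    without common letters. *)
Definition before (u v : naword) : bool :=
  (word_degree v < word_degree u)%N ||
  (word_degree u == word_degree v) &&
  (head 0 (letters u) < head 0 (letters v))%N.

(** The boolean is the parity of the number of exchanges of factors, so that w
    is equal to (-1)^(normal w).1 (normal w).2 in anticommutative algebras. *)
Fixpoint normal (w : naword) : bool * naword :=
  match w with
  | Var i => (false, Var i)
  | Mul u v =>
      let: (s, u') := normal u in
      let: (t, v') := normal v in
      if before u' v' then (s (+) t, Mul u' v') else (~~ (s (+) t), Mul v' u')
  end.

Definition normal_words n : seq naword :=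
  [seq u <- words (iota 0 n) n n | multilinear n u && (normal u == (false, u))].

(** * Malcev relations and evaluations at weight vectors *)

Definition malcev_terms (a b c d : naword) : seq (int * naword) := [::
  (1, Mul (Mul (Mul a c) b) d); (1, Mul (Mul (Mul d a) c) b);
  (1, Mul (Mul (Mul c b) d) a); (1, Mul (Mul (Mul b d) a) c);
  (-1, Mul (Mul a b) (Mul c d))].

Definition malcev_instance (s : seq nat) : seq (int * naword) :=
  let x i := Var (nth 0%N s i) in malcev_terms (x 0) (x 1) (x 2) (x 3).

(** A list sum which, unlike big operators, reduces during computation. *)
Definition sumz (s : seq int) : int := foldr +%R 0 s.

Definition relation_coef (s : seq nat) (b : naword) : int :=
  sumz [seq if (normal t.2).2 == b then (-1) ^+ (normal t.2).1 * t.1 else 0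
       | t <- malcev_instance s].

(** The structure constants, in the order of product_table, after the rescaling
    of basis_ratio below.  They are those of the traceless split octonions
    under the commutator, up to normalization. *)
Definition octonion_constants : seq int :=
  [:: 1; 1; 1; 1; -2; -1; 1; 2; -1; -1; 2; -1; -1; 1; -1].

Definition octonion_entry (e : int * int) : int :=
  octonion_constants`_(index e [seq e.1 | e <- product_table]).

Definition octonion_constant (p q : int) : int :=
  octonion_entry (p, q) - octonion_entry (q, p).

Fixpoint weight (m : nat -> int) (w : naword) : int :=
  match w with
  | Var i => m i
  | Mul u v => weight m u + weight m v
  end.

Fixpoint weight_coef (m : nat -> int) (w : naword) : int :=
  match w with
  | Var i => 1
  | Mul u v => weight_coef m u * weight_coef m v *
               octonion_constant (weight m u) (weight m v)
  end.

(** Weights at which words are evaluated, in all orders, with the coefficient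
    of these evaluations in the Gram identity.  The coefficients solve the
    linear system expressing that the Gram matrix is scalar.  The vectors of
    weights 6, 0 and -6 span a Lie algebra, so evaluations at them do not detect
    the Jacobi expression; those that involve weights -2 and -4 do. *)
Definition patterns (n : nat) : seq (int * seq int) :=
  match n with
  | 1 => [:: (1, [:: 6])]
  | 2 => [:: (1, [:: 6; 0])]
  | 3 => [:: (3, [:: 6; 0; 0]); (1, [:: 6; 0; -2])]
  | _ => [:: (10, [:: 6; 0; 0; 0]); (6, [:: 6; 0; 0; -2]);
             (15, [:: 6; 0; 0; -6]); (4, [:: 6; 0; -2; -4])]
  end.

Definition gram_scale (n : nat) : int :=
  match n with 1 => 1 | 2 => 2 | 3 => 18 | _ => 648 end.

Definition orderings n := permutations (iota 0 n).

Definition relation_orderings n := if n == 4 then orderings n else [::].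

Definition assignment (m : seq int) (s : seq nat) (i : nat) : int :=
  m`_(nth 0%N s i).

(** The matrix of the sum of the rank one operators T_t^T T_t and rho^T rho,
    with their coefficients, in the basis of normal words. *)
Definition gram n (b c : naword) : int :=
  sumz [seq sumz [seq q.1 * weight_coef (assignment q.2 s) b *
                      weight_coef (assignment q.2 s) c | s <- orderings n]
       | q <- patterns n] +
  sumz [seq 27 * relation_coef s b * relation_coef s c
       | s <- relation_orderings n].

Definition total_weight n (m : nat -> int) : int := sumz (map m (iota 0 n)).

(** The finite verifications, gathered so that the list of normal words is
    computed once.  The condition on weights makes each evaluation land in a
    nonzero weight space, where the integer T_t can be read off. *)
Definition certificate n : bool :=
  let B := normal_words n in
  [&& uniq B,
      all (fun u => multilinear n u ==> ((normal u).2 \in B))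
          (words (iota 0 n) n n),
      all (fun b => all (fun c => gram n b c == gram_scale n *+ (b == c)) B) B,
      all (fun q => all (fun s =>
             total_weight n (assignment q.2 s) \in [:: 6; 4; 2; 0; -2; -4; -6])
           (orderings n)) (patterns n) &
      all (fun s => all (fun t => (normal t.2).2 \in B) (malcev_instance s))
          (relation_orderings n)].

Lemma certificateP n : (0 < n <= 4)%N -> certificate n.
Proof.
case: n => [|[|[|[|[|n]]]]] le_n; [by [] | | | | | by case/andP: le_n].
all: by vm_compute.
Qed.

Lemma gram_scale_neq0 n : gram_scale n != 0.
Proof. by move: n; do 5?case. Qed.

Lemma sumzE (I : Type) (r : seq I) (F : I -> int) :
  sumz (map F r) = \sum_(i <- r) F i.
Proof. by rewrite /sumz foldrE big_map. Qed.

Lemma weight_normal m w : weight m (normal w).2 = weight m w.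
Proof.
elim: w => //= u <- v <-; case: (normal u) (normal v) => s u' [t v'] /=.
by case: ifP => _ //=; rewrite addrC.
Qed.

Lemma weight_coef_normal m w :
  weight_coef m w = (-1) ^+ (normal w).1 * weight_coef m (normal w).2.
Proof.
elim: w => [i|u IHu v IHv] /=; first by rewrite mulr1.
rewrite {}IHu {}IHv -(weight_normal m u) -(weight_normal m v).
case: (normal u) (normal v) => s u' [t v'] /=.
rewrite mulrACA -signr_addb; case: ifP => _ /=; first by rewrite !mulrA.
rewrite signrN mulNr -mulrN -[LHS]mulrA /octonion_constant; congr (_ * _).
by rewrite -[RHS]mulrN opprB [weight_coef m v' * _]mulrC.
Qed.

(** * Words in a Malcev algebra factor through V(6) *)

Section MalcevAlgebra.
Context (K : numFieldType) (A : lmodType K) (op : {bilinear A -> A -> A}).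
Hypothesis opC : forall a b, op a b = - op b a.
Hypothesis op_malcev : forall a b c d,
  op (op (op a c) b) d + op (op (op d a) c) b + op (op (op c b) d) a
  + op (op (op b d) a) c - op (op a b) (op c d) = 0.

Lemma word_eval_normal x w :
  word_eval op x w = (-1) ^+ (normal w).1 *: word_eval op x (normal w).2.
Proof.
elim: w => [i|u IHu v IHv] /=; first by rewrite scale1r.
rewrite {}IHu {}IHv; case: (normal u) (normal v) => s u' [t v'] /=.
rewrite linearZl_LR linearZr_LR /= scalerA -signr_addb.
by case: ifP => _ //=; rewrite opC scalerN -scaleNr -signrN.
Qed.

Lemma relation_eval y s :
    {in malcev_instance s, forall t, (normal t.2).2 \in normal_words 4} ->
    uniq (normal_words 4) ->
  \sum_(b <- normal_words 4) (relation_coef s b)%:~R *: word_eval op y b = 0.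
Proof.
move=> sB uB; pose x i := y (nth 0%N s i).
rewrite -[RHS](op_malcev (x 0) (x 1) (x 2) (x 3)).
under eq_bigr => b _ do rewrite /relation_coef sumzE rmorph_sum scaler_suml.
rewrite exchange_big /=.
transitivity (\sum_(t <- malcev_instance s) t.1%:~R *: word_eval op y t.2).
  rewrite big_seq [RHS]big_seq; apply: eq_bigr => t /sB tB.
  rewrite (bigD1_seq _ tB uB) /= eqxx big1 => [|b neq_b].
    rewrite [in RHS]word_eval_normal addr0 scalerA.
    by rewrite intrM rmorph_sign mulrC.
  by rewrite eq_sym (negPf neq_b) scale0r.
rewrite !big_cons big_nil /=.
by rewrite addr0 mulrN1z scaleN1r !scale1r !addrA.
Qed.

(** Up to a coefficient, the functions z_t: since the Gram identity is
    symmetric, T_t is used twice, as a functional and as a vector. *)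
Definition dual_value n y (m : nat -> int) : A :=
  \sum_(b <- normal_words n) (weight_coef m b)%:~R *: word_eval op y b.

(** The row b of the Gram identity, evaluated in A, where the Malcev relations
    vanish. *)
Lemma factorization_normal n y b : (0 < n <= 4)%N -> b \in normal_words n ->
  (gram_scale n)%:~R *: word_eval op y b =
  \sum_(q <- patterns n) \sum_(s <- orderings n)
     (weight_coef (assignment q.2 s) b)%:~R *:
       (q.1%:~R *: dual_value n y (assignment q.2 s)).
Proof.
move=> n4 bB; have /and5P[uB _ /allP gB _ /allP rB] := certificateP n4.
transitivity (\sum_(c <- normal_words n) (gram n b c)%:~R *: word_eval op y c).
  rewrite (bigD1_seq b bB uB) /= big_seq_cond big1 => [|c /andP[cB neq_c]].
    by rewrite addr0 (eqP (allP (gB b bB) b bB)) eqxx.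
  by rewrite (eqP (allP (gB b bB) c cB)) eq_sym (negPf neq_c) scale0r.
under eq_bigr => c _ do
  rewrite /gram !sumzE intrD scalerDl !rmorph_sum !scaler_suml.
rewrite big_split /= [X in _ + X]exchange_big [X in _ + X]big_seq.
rewrite [X in _ + X]big1 ?addr0 => [|s ss].
  rewrite exchange_big; apply: eq_bigr => q _ /=.
  under eq_bigr => c _ do rewrite sumzE rmorph_sum scaler_suml.
  rewrite exchange_big; apply: eq_bigr => s _ /=.
  rewrite /dual_value !scaler_sumr; apply: eq_bigr => c _.
  by rewrite !scalerA !intrM [q.1%:~R * _]mulrC.
under eq_bigr => c _ do rewrite intrM -scalerA.
rewrite -scaler_sumr; have /allP := rB s ss.
move: ss uB; rewrite /relation_orderings; case: (n =P 4) => // -> _ uB tB.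
by rewrite relation_eval ?scaler0.
Qed.

(** Both sides are multiplied by the same sign when u is put in normal form,
    since the product of V(6) is anticommutative too. *)
Lemma factorization n y u : (0 < n <= 4)%N -> multilinear n u ->
  (gram_scale n)%:~R *: word_eval op y u =
  \sum_(q <- patterns n) \sum_(s <- orderings n)
     (weight_coef (assignment q.2 s) u)%:~R *:
       (q.1%:~R *: dual_value n y (assignment q.2 s)).
Proof.
move=> n4 ml; have /and5P[_ /allP nB _ _ _] := certificateP n4.
have bB : (normal u).2 \in normal_words n.
  have /nB/implyP-> // : u \in words (iota 0 n) n n.
  rewrite -{3}(multilinear_degree ml) mem_words ?(multilinear_degree ml) //.
  by move=> i; rewrite (perm_mem ml).
rewrite word_eval_normal scalerA mulrC -scalerA factorization_normal //.
rewrite scaler_sumr; apply: eq_bigr => q _.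
rewrite scaler_sumr; apply: eq_bigr => s _.
by rewrite (weight_coef_normal _ u) intrM rmorph_sign -scalerA.
Qed.

End MalcevAlgebra.

(** * The algebra V(6) in a rescaled basis *)

(** The numerator and denominator of the factors by which v_p is multiplied.
    Starting from b_6 = v_6, b_-2 = v_-2 and b_0 = v_0 / 20, which acts with
    eigenvalues 1, -1 and 0, the other vectors are fixed by [b_6, b_-2] = b_4,
    [b_6, b_-6] = b_0, [b_4, b_-4] = b_0 and [b_6, b_-4] = b_2. *)
Definition basis_ratio (p : int) : nat * nat :=
  if p == 4 then (10, 1) else if p == 2 then (1, 300)
  else if p == 0 then (1, 20) else if p == -4 then (1, 1200)
  else if p == -6 then (1, 20) else (1, 1).

Lemma basis_ratio_gt0 p :
  (0 < (basis_ratio p).1)%N && (0 < (basis_ratio p).2)%N.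
Proof. by rewrite /basis_ratio; do 5?case: ifP. Qed.

Lemma octonion_entry0 e :
  e \notin [seq e.1 | e <- product_table] -> octonion_entry e = 0.
Proof. by move=> e_out; rewrite /octonion_entry memNindex. Qed.

Lemma product_table_decreasing p q :
  q < p -> (q, p) \notin [seq e.1 | e <- product_table].
Proof.
move=> lt_qp; apply/mapP => -[[[p' q'] cr] tab_e [Dq Dp]].
have /allP/(_ _ tab_e) /= : all (fun e => e.1.2 < e.1.1) product_table by [].
by rewrite -Dp -Dq ltNge (ltW lt_qp).
Qed.

Lemma octonion_constantC p q :
  octonion_constant q p = - octonion_constant p q.
Proof. by rewrite /octonion_constant opprB. Qed.

(** The rescaled table, with denominators cleared to remain in the integers. *)
Lemma product_table_rescaled p q c r : ((p, q), (c, r)) \in product_table ->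
  r = p + q /\
  (basis_ratio p).1%:R * (basis_ratio q).1%:R * c * (basis_ratio r).2%:R =
  octonion_constant p q * (basis_ratio r).1%:R *
    ((basis_ratio p).2%:R * (basis_ratio q).2%:R).
Proof.
pose ok (e : (int * int) * (int * int)) :=
  let: ((p, q), (c, r)) := e in (r == p + q) &&
  ((basis_ratio p).1%:R * (basis_ratio q).1%:R * c * (basis_ratio r).2%:R ==
   octonion_constant p q * (basis_ratio r).1%:R *
     ((basis_ratio p).2%:R * (basis_ratio q).2%:R)).
have /allP ok_table : all ok product_table by vm_compute.
by move/ok_table => /andP[/eqP -> /eqP].
Qed.

Section Bracket.
Context (K : numFieldType) (alpha : {linear ext2_V6 K -> V6 K}).

Lemma wedge_linearl (y : 'rV[K]_7) : linear (fun x => wedge x y).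
Proof.
move=> c x x'; apply/val_inj; rewrite linearP /= !val_wedge linearP /=.
rewrite mulmxDl mulmxDr -scalemxAl -scalemxAr scalerBr.
by rewrite opprD addrACA.
Qed.

Lemma wedgeC (x y : 'rV[K]_7) : wedge x y = - wedge y x.
Proof. by apply/val_inj; rewrite linearN /= !val_wedge opprB. Qed.

Lemma bracketC x y : bracket alpha x y = - bracket alpha y x.
Proof. by rewrite /bracket wedgeC linearN. Qed.

Fact bracket_bilinear : bilinear_for *:%R *:%R (bracket alpha).
Proof.
split=> u c x y /=; first by rewrite /bracket wedge_linearl linearP.
by rewrite 3!(bracketC u) /bracket wedge_linearl linearP opprD scalerN.
Qed.

HB.instance Definition _ :=
  bilinear_isBilinear.Build K 'rV[K]_7 'rV[K]_7 'rV[K]_7 *:%R *:%R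
    (bracket alpha) bracket_bilinear.

Hypothesis alpha_normalized : normalized (bracket alpha).

Definition basis_scale (p : int) : K :=
  (basis_ratio p).1%:R / (basis_ratio p).2%:R.

Definition octonion_basis (p : int) : 'rV[K]_7 := basis_scale p *: v K p.

Lemma octonion_basis_neq0 p : p \in [:: 6; 4; 2; 0; -2; -4; -6] ->
  octonion_basis p != 0.
Proof.
move=> p6; rewrite scaler_eq0 negb_or; apply/andP; split.
  rewrite mulf_neq0 ?invr_eq0 ?pnatr_eq0 -?lt0n //;
    by case/andP: (basis_ratio_gt0 p).
have [i ->] : exists i : 'I_7, p = 6 - 2 * i%:Z.
  move: p6; rewrite !inE => p6.
  have lt7 : (`|(6 - p) %/ 2|%Z < 7)%N by lia.
  by exists (Ordinal lt7) => /=; lia.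
rewrite vE; apply/eqP => /rowP/(_ i)/eqP; rewrite !mxE !eqxx /=.
by rewrite oner_eq0.
Qed.

Lemma bracket_basis p q : bracket alpha (octonion_basis p) (octonion_basis q) =
  (octonion_constant p q)%:~R *: octonion_basis (p + q).
Proof.
wlog lt_qp : p q / q < p => [ih|].
  have [lt_pq|lt_qp|->] := ltgtP p q; last 2 first.
  - exact: ih.
  - rewrite /octonion_constant subrr scale0r /bracket.
    suff -> : wedge (octonion_basis q) (octonion_basis q) = 0 by exact: linear0.
    by apply/val_inj; rewrite [RHS]linear0 /= val_wedge subrr.
  by rewrite bracketC ih // octonion_constantC rmorphN scaleNr opprK addrC.
rewrite /octonion_basis linearZl_LR linearZr_LR /= scalerA.
have [tab tab0] := alpha_normalized.
have [pq|pq] := boolP ((p, q) \in [seq e.1 | e <- product_table]); last first.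
  by rewrite tab0 // scaler0 /octonion_constant !octonion_entry0 ?subrr ?scale0r
    ?(product_table_decreasing lt_qp).
case/mapP: pq => -[[p' q'] [c r]] tab_e [Dp Dq].
rewrite -{}Dp -{}Dq in tab_e *; rewrite (tab _ _ _ _ tab_e) !scalerA.
have [<- ratio_pq] := product_table_rescaled tab_e; congr (_ *: _).
have den0 s : (basis_ratio s).2%:R != 0 :> K.
  by rewrite pnatr_eq0 -lt0n; case/andP: (basis_ratio_gt0 s).
rewrite /basis_scale mulf_div mulrA mulrAC; apply/eqP.
rewrite eqr_div ?mulf_neq0 //; apply/eqP.
have := congr1 (fun z : int => z%:~R : K) ratio_pq.
by rewrite !intrM !rmorph_nat.
Qed.

End Bracket.

(** * Identities of V(6) and of Malcev algebras *)

Section Identities.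
Context (K : numFieldType) (alpha : {linear ext2_V6 K -> V6 K}).
Hypothesis alpha_normalized : normalized (bracket alpha).
Local Notation mu := (bracket alpha).
Local Notation b := (@octonion_basis K).

(** Weights add up in products and weight spaces have dimension at most 1. *)
Lemma word_eval_basis (m : nat -> int) w :
  word_eval mu (b \o m) w = (weight_coef m w)%:~R *: b (weight m w).
Proof.
elim: w => [i|u IHu v IHv] /=; first by rewrite scale1r.
rewrite IHu IHv linearZl_LR linearZr_LR /= bracket_basis // !scalerA.
by rewrite !intrM [_%:~R * _%:~R as X in X * _]mulrC.
Qed.

Lemma weight_multilinear n m u : multilinear n u ->
  weight m u = total_weight n m.
Proof.
move=> ml; rewrite /total_weight sumzE -(perm_big _ ml) /=.
by elim: u {ml} => [i|u IHu v IHv] /=; rewrite ?big_seq1 // big_cat IHu IHv.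
Qed.

Lemma poly_evalE (A : lmodType K) (op : A -> A -> A) x (f : napoly K) :
  poly_eval op x f =
  \sum_(p <- [seq (coeff w f, w) | w <- dom f]) p.1 *: word_eval op x p.2.
Proof.
by rewrite /poly_eval -{1}[f]Freeg_dom fglift_Freeg /prelift.
Qed.

Lemma malcev_laws (A : lmodType K) (op : {bilinear A -> A -> A}) :
    (forall g, malcev_identities g -> satisfies op g) ->
  (forall x y, op x y = - op y x) /\
  forall x y z t, op (op (op x z) y) t + op (op (op t x) z) y
    + op (op (op z y) t) x + op (op (op y t) x) z - op (op x y) (op z t) = 0.
Proof.
move=> opM; split=> [x y|x y z t].
  have := opM _ (or_introl erefl) (nth 0 [:: x; y]).
  rewrite /poly_eval /anticommutativity -freeg_cat fglift_Freeg.
  rewrite /prelift !big_cons big_nil /= !scale1r addr0 => /eqP.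
  by rewrite addr_eq0 => /eqP.
have := opM _ (or_intror erefl) (nth 0 [:: x; y; z; t]).
rewrite /poly_eval /malcev_identity freegUN -!freeg_cat fglift_Freeg.
by rewrite /prelift !big_cons big_nil /= !scale1r scaleN1r addr0 !addrA.
Qed.

Lemma vanishes_weight_coef n m (r : seq (K * naword)) :
    {in r, forall p, multilinear n p.2} -> b (total_weight n m) != 0 ->
    vanishes mu r ->
  \sum_(p <- r) p.1 * (weight_coef m p.2)%:~R = 0.
Proof.
move=> ml b0 /(_ (b \o m)) r0; apply/eqP.
suff : (\sum_(p <- r) p.1 * (weight_coef m p.2)%:~R) *:
         b (total_weight n m) == 0.
  by rewrite scaler_eq0 (negPf b0) orbF.
rewrite -{}[X in _ == X]r0 scaler_suml; apply/eqP.
rewrite big_seq [RHS]big_seq; apply: eq_bigr => p /ml mlp.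
by rewrite word_eval_basis (weight_multilinear _ mlp) -scalerA.
Qed.

(** Each T_t is linear, so it kills a combination of words that vanishes on
    V(6); the factorization does the rest. *)
Lemma malcev_multilinear_identities (A : lmodType K)
    (op : {bilinear A -> A -> A}) n :
    (forall g, malcev_identities g -> satisfies op g) -> (n <= 4)%N ->
  inherits_multilinear_identities mu op n.
Proof.
move=> opM n4 r ml r0 x; have [opC op_malcev] := malcev_laws opM.
case: n n4 ml => [|n] n4 ml.
  rewrite big_seq big1 // => p /ml/multilinear_degree deg0.
  by have := word_degree_gt0 p.2; rewrite deg0.
have scale0 : (gram_scale n.+1)%:~R != 0 :> K.
  by rewrite intr_eq0 gram_scale_neq0.
apply: (scalerI scale0); rewrite scaler0 scaler_sumr.
transitivity (\sum_(q <- patterns n.+1) \sum_(s <- orderings n.+1)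
    (\sum_(p <- r) p.1 * (weight_coef (assignment q.2 s) p.2)%:~R) *:
    (q.1%:~R *: dual_value op n.+1 x (assignment q.2 s))).
  under [RHS]eq_bigr => q _ do under eq_bigr => s _ do rewrite scaler_suml.
  under [RHS]eq_bigr => q _ do rewrite exchange_big.
  rewrite [RHS]exchange_big [LHS]big_seq [RHS]big_seq.
  apply: eq_bigr => p /ml mlp.
  rewrite scalerA mulrC -scalerA (factorization opC op_malcev) // scaler_sumr.
  apply: eq_bigr => q _; rewrite scaler_sumr; apply: eq_bigr => s _.
  by rewrite -scalerA.
have /and5P[_ _ _ /allP weights _] := @certificateP n.+1 n4.
rewrite big_seq big1 // => q /weights/allP wq.
rewrite big_seq big1 // => s /wq/(octonion_basis_neq0 K) b0.
by rewrite (vanishes_weight_coef ml b0 r0) scale0r.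
Qed.

Theorem malcev_consequence (f : napoly K) :
  degree_le 4 f -> satisfies mu f -> consequence (@malcev_identities K) f.
Proof.
move=> deg_f f0 A op opM x; rewrite poly_evalE.
apply: (@inherits_identities K _ _ mu op 4) => [n n4|p|y].
- exact: malcev_multilinear_identities.
- by case/mapP=> w wf ->; apply: deg_f.
by rewrite -poly_evalE f0.
Qed.

End Identities.

Theorem lemma4p1 (R : realType)
    (alpha : {linear ext2_V6 R[i] -> V6 R[i]})
    (alpha_morphism : sl2_morphism alpha)
    (alpha_normalized : normalized (bracket alpha))
    (f : napoly R[i]) :
  degree_le 4 f -> satisfies (bracket alpha) f ->
  consequence (@malcev_identities R[i]) f.
Proof. exact: malcev_consequence. Qed.
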